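(* Let $r$ and $k$ be positive integers, let $n=2^k$, and let $V_1,\dots,V_n$ be finite-dimensional vector spaces over a fixed base field with $\dim V_i\ge r$ for all $i$. (1) For the standard (left to right) ordering of the leaves of both the train track tree and the perfect binary tree, $$TT(r,2^k)\subseteq HF(r^2,k)$$ as subsets of $V_1\otimes\dots\otimes V_n$. (2) However, for every non-negative integer $r'<r^2$ and every reordering of the leaves of the train track tree, i.e. every permutation $\sigma$ of $\{1,\dots,n\}$, $$TT_\sigma(r,2^k)\not\subseteq HF(r',k).$$
   Context: All trees are finite rooted full binary trees: each vertex has either exactly two children (a node) or no children (a leaf). For a vertex $v$, $\downarrow v$ denotes the set of leaves that are descendants of $v$ (if $v$ is a leaf, $\downarrow v=\{v\}$). Tensor network states: let $\mathfrak T$ be such a tree whose leaves are labelled bijectively by $\{1,\dots,n\}$, and let $f$ be a function from the vertices of $\mathfrak T$ to the non-negative integers. $TNS_{\mathfrak T,f}\subset V_1\otimes\dots\otimes V_n$ is the set of tensors $t$ for which there exist linear subspaces $U_v$ with $\dim U_v\le f(v)$, one for each vertex $v$, such that: $U_v\subset V_i$ if $v$ is the leaf labelled $i$; $U_v\subset U_{v_1}\otimes U_{v_2}$ if $v$ is a node with children $v_1,v_2$; and $t\in U_{\mathfrak r}$ for the root $\mathfrak r$. (Tensor factors are rearranged according to their labels.) For an integer $s$, $TNS_{\mathfrak T,s}$ means $TNS_{\mathfrak T,f}$ with $f$ constant equal to $s$. Perfect binary tree of depth $k$ with the standard left-to-right labelling: the full binary tree with $2^k$ leaves in which every leaf has exactly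 $k$ ancestors, labelled so that the sets $\downarrow v$ are exactly the sets $\{2^m(i-1)+1,\dots,2^m i\}$ for $0\le m\le k$, $1\le i\le 2^{k-m}$. $HF(s,k)$ denotes $TNS_{\mathfrak T,s}$ for this labelled tree. Train track tree with $n$ leaves: the full binary tree with $n$ leaves in which each node has at least one leaf as a child. With the leaves ordered by a permutation $\sigma$, the sets $\downarrow v$ are exactly the singletons $\{\sigma(j)\}$, $1\le j\le n$, and the sets $\{\sigma(1),\dots,\sigma(j)\}$, $2\le j\le n$. $TT_\sigma(r,n)$ denotes $TNS_{\mathfrak T,r}$ for this labelled tree, and $TT(r,n)=TT_{\mathrm{id}}(r,n)$ is the one for the standard left-to-right ordering.
   Formalization: Part (2) is stated only for r = 1 or k ≥ 3; for r ≥ 2 and k ≤ 2 it fails as written, since TT(r,2^k) ⊆ HF(r,k) for the standard ordering and r < r². Those k are excluded for all r' and all σ, though some individual cases hold. *)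

(* Defs.v *)
From HB Require Import structures.
From mathcomp Require Import all_boot all_order all_algebra all_fingroup.

Set Implicit Arguments.
Unset Strict Implicit.
Unset Printing Implicit Defensive.

Import GRing.Theory.
Local Open Scope ring_scope.

(* Full binary trees whose leaves are labelled by elements of I. *)

Inductive tree (I : Type) : Type :=
| Leaf of I
| Node of tree I & tree I.

Arguments Leaf {I} i.
Arguments Node {I} v1 v2.

(* A vertex is identified with the subtree hanging from it.  When the leaf
   labels are pairwise distinct, as in all the trees used below, distinct
   vertices carry distinct subtrees, so that a family indexed by the vertices
   is the same thing as a family indexed by the subtrees. *)
Fixpoint is_vertex (I : Type) (T v : tree I) : Prop :=
  v = T \/
  match T with
  | Leaf _ => False
  | Node T1 T2 => is_vertex T1 v \/ is_vertex T2 v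
  end.

Fixpoint leaves (I : finType) (v : tree I) : {set I} :=
  match v with
  | Leaf i => [set i]
  | Node v1 v2 => leaves v1 :|: leaves v2
  end.

(* Tensor products.  For S a set of labels, the tensor product of the V i,
   i \in S, is the space of families of coordinates with respect to the basis
   of pure tensors built from the bases [vbasis fullv] of the V i.  Indexing by
   sets of labels makes the rearrangement of the factors implicit. *)

Definition multi_index (K : fieldType) (I : finType) (V : I -> vectType K)
    (S : {set I}) : finType :=
  {dffun forall i : {i : I | i \in S}, 'I_(\dim {: V (val i)})}.

Definition tensor (K : fieldType) (I : finType) (V : I -> vectType K)
    (S : {set I}) : vectType K :=
  {ffun multi_index V S -> K^o}.

Definition restr (K : fieldType) (I : finType) (V : I -> vectType K)
    (S1 S2 : {set I}) (sS12 : S1 \subset S2) (a : multi_index V S2) :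
    multi_index V S1 :=
  [ffun i : {i : I | i \in S1} =>
    a (exist _ (val i) (subsetP sS12 (val i) (valP i)))
      : 'I_(\dim {: V (val i)})].

(* The product V_S1 x V_S2 -> V_(S1 U S2), for disjoint S1 and S2. *)
Definition tmul (K : fieldType) (I : finType) (V : I -> vectType K)
    (S1 S2 : {set I}) (x : tensor V S1) (y : tensor V S2) :
    tensor V (S1 :|: S2) :=
  [ffun a : multi_index V (S1 :|: S2) =>
    (x (restr (subsetUl S1 S2) a) * y (restr (subsetUr S1 S2) a) : K^o)].

(* The canonical isomorphism from V i to the tensor product over [set i]. *)
Definition tensor1 (K : fieldType) (I : finType) (V : I -> vectType K)
    (i : I) (x : V i) : tensor V [set i] :=
  [ffun a : multi_index V [set i] =>
    (coord (vbasis {: V i}) (a (exist _ i (set11 i))) x : K^o)].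

Definition vertex_space (K : fieldType) (I : finType) (V : I -> vectType K)
    (v : tree I) : vectType K :=
  match v with
  | Leaf i => V i
  | Node _ _ => tensor V (leaves v)
  end.

Definition to_tensor (K : fieldType) (I : finType) (V : I -> vectType K)
    (v : tree I) : vertex_space V v -> tensor V (leaves v) :=
  match v with
  | Leaf i => @tensor1 K I V i
  | Node _ _ => id
  end.

(* The tensor product of U1 and U2, as a subspace. *)
Definition tensv (K : fieldType) (I : finType) (V : I -> vectType K)
    (v1 v2 : tree I) (U1 : {vspace vertex_space V v1})
    (U2 : {vspace vertex_space V v2}) :
    {vspace vertex_space V (Node v1 v2)} :=
  <<[seq tmul (to_tensor x) (to_tensor y)
      | x <- (vbasis U1 : seq _), y <- (vbasis U2 : seq _)]>>%VS.

(* Tensor network states.  [leaves T] is the full set of labels when the leaves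
   of T are labelled bijectively, and the last clause then says that t, up to
   the identification along [leaves T = setT], is an element of U T. *)
Definition TNS (K : fieldType) (I : finType) (V : I -> vectType K)
    (T : tree I) (f : tree I -> nat) (t : tensor V [set: I]) : Prop :=
  exists U : forall v : tree I, {vspace vertex_space V v},
    [/\ forall v, is_vertex T v -> (\dim (U v) <= f v)%N,
        forall v1 v2, is_vertex T (Node v1 v2) ->
          (U (Node v1 v2) <= tensv (U v1) (U v2))%VS
      & exists2 u, u \in U T &
          t = [ffun a => to_tensor u (restr (subsetT (leaves T)) a)]].

Lemma pow2_split k : (2 ^ k + 2 ^ k = 2 ^ k.+1)%N.
Proof. by rewrite expnS mul2n addnn. Qed.

(* The perfect binary tree of depth k, with leaves g 0, ..., g (2^k - 1) from
   left to right. *)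
Fixpoint perfect_tree (I : Type) (k : nat) : ('I_(2 ^ k) -> I) -> tree I :=
  match k with
  | 0 => fun g => Leaf (g ord0)
  | k'.+1 => fun g =>
      Node
        (perfect_tree (fun i => g (cast_ord (pow2_split k') (lshift _ i))))
        (perfect_tree (fun i => g (cast_ord (pow2_split k') (rshift _ i))))
  end.

(* The train track tree with leaves s 0, ..., s (n - 1): the leaves below its
   nodes are the sets {s 0, ..., s j}, 1 <= j < n. *)
Definition train_track_tree (n : nat) (n_gt0 : (0 < n)%N) (s : {perm 'I_n}) :
    tree 'I_n :=
  foldl (fun T j => Node T (Leaf (s j))) (Leaf (s (Ordinal n_gt0)))
        (behead (enum 'I_n)).

Definition HF (K : fieldType) (s k : nat) (V : 'I_(2 ^ k) -> vectType K) :
    tensor V [set: 'I_(2 ^ k)] -> Prop :=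
  TNS (perfect_tree (fun i : 'I_(2 ^ k) => i)) (fun=> s).

Definition TT (K : fieldType) (n : nat) (n_gt0 : (0 < n)%N) (s : {perm 'I_n})
    (r : nat) (V : 'I_n -> vectType K) : tensor V [set: 'I_n] -> Prop :=
  TNS (train_track_tree n_gt0 s) (fun=> r).

Lemma pow2_gt0 k : (0 < 2 ^ k)%N.
Proof. by rewrite expn_gt0. Qed.

(* Main.v *)
From HB Require Import structures.
Require Import Defs.
From mathcomp Require Import all_boot all_order all_algebra all_fingroup.
From mathcomp Require Import zify.

(* A tensor t is a tensor network state for (T, f) iff, for every vertex v, the
   flattening of t along the leaves below v has rank at most f v: the slices of
   t along these leaves span the smallest admissible space U_v.  Flattening
   ranks are invariant under complement and submultiplicative on disjoint
   unions.  An interval [a, b) is the complement of the disjoint union of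
   [0, a) and [b, n), hence has rank at most r^2 for a train track tensor.
   Conversely, among the pairs {0,1}, {2,3}, {4,5} of leaves of the perfect
   tree one, {a, b}, is neither the first two nor the last two leaves of the
   train track.  It then has partners c, d such that no edge of the train track
   tree separates both a from c and b from d, and the tensor
   sum_(x, y < r) (e_x)_a (e_x)_c (e_y)_b (e_y)_d, padded by e_0 elsewhere, is a
   train track tensor of flattening rank r^2 along {a, b}. *)

Set Implicit Arguments.
Unset Strict Implicit.
Unset Printing Implicit Defensive.

Import GRing.Theory.

(** * Slices and flattening ranks *)

Section Slices.

Local Open Scope ring_scope.

Variables (K : fieldType) (I : finType) (V : I -> vectType K).

Notation M := (multi_index V [set: I]).
Notation F := (tensor V [set: I]).
Implicit Types (S : {set I}) (a c : M) (t x y : F) (A B : {vspace F}).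

Definition coordinate a (i : I) : 'I_(\dim {: V i}) := a (exist _ i (in_setT i)).

Definition mix S a c : M :=
  [ffun i => (if val i \in S then a i else c i) : 'I_(\dim {: V (val i)})].

Lemma multi_indexP a c :
  (forall i, coordinate a i = coordinate c i :> nat) -> a = c.
Proof.
move=> eq_ac; apply/ffunP=> -[i iT]; apply: val_inj => /=.
by have := eq_ac i; rewrite /coordinate (bool_irrelevance (in_setT i) iT).
Qed.

Lemma coordinate_mix S a c i :
  coordinate (mix S a c) i = if i \in S then coordinate a i else coordinate c i.
Proof. by rewrite /coordinate ffunE. Qed.

Lemma mixC S a c : mix (~: S) a c = mix S c a.
Proof.
by apply: multi_indexP => i; rewrite !coordinate_mix inE; case: (i \in S).
Qed.

Lemma mixaa S a : mix S a a = a.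
Proof. by apply: multi_indexP => i; rewrite !coordinate_mix if_same. Qed.

Lemma mix_id S a b c : mix S (mix S a b) c = mix S a c.
Proof. by apply: multi_indexP => i; rewrite !coordinate_mix; case: (i \in S). Qed.

Lemma mixT a c : mix setT a c = a.
Proof. by apply: multi_indexP => i; rewrite coordinate_mix inE. Qed.

Lemma mixU S1 S2 a c : mix S1 a (mix S2 a c) = mix (S1 :|: S2) a c.
Proof.
by apply: multi_indexP => i; rewrite !coordinate_mix inE; do 2!case: (i \in _).
Qed.

Lemma mix_sub S1 S2 a c : S1 \subset S2 -> mix S2 (mix S1 a c) c = mix S1 a c.
Proof.
move=> /subsetP sS; apply: multi_indexP => i; rewrite !coordinate_mix.
by case: (boolP (i \in S1)) => [/sS -> | _]; case: (i \in S2).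
Qed.

Lemma mix_disjointC S1 S2 a b c : [disjoint S1 & S2] ->
  mix S1 a (mix S2 b c) = mix S2 b (mix S1 a c).
Proof.
move=> /disjoint_setI0 dS; apply: multi_indexP => i; rewrite !coordinate_mix.
have : (i \in S1 :&: S2) = false by rewrite dS inE.
by rewrite inE; do 2!case: (i \in _).
Qed.

(** Slices are kept as tensors over all labels, constant in the coordinates outside [S], so that
    slices along different sets lie in one ambient space. *)
Definition slice S c t : F := [ffun a => t (mix S a c)].

Lemma slice_is_linear S c : linear (slice S c).
Proof. by move=> k x y; apply/ffunP=> a; rewrite !ffunE. Qed.

HB.instance Definition _ S c :=
  GRing.isLinear.Build K F F *:%R (slice S c) (slice_is_linear S c).

Definition slices S t : {vspace F} := <<[seq slice S c t | c : M]>>%VS.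

(** The rank of the matrix of [t] with rows indexed by the coordinates in [S] and columns by those
    outside [S]. *)
Definition flat_rank S t := \dim (slices S t).

Lemma mem_slice S c t : slice S c t \in slices S t.
Proof. by apply: memv_span; apply: image_f. Qed.

Lemma slices_subvP S t (U : {vspace F}) :
  reflect (forall c, slice S c t \in U) (slices S t <= U)%VS.
Proof.
apply: (iffP span_subvP) => [sU c | sU _ /imageP[c _ ->]]; last exact: sU.
by apply: sU; apply: image_f.
Qed.

Definition local S x := forall a c, x (mix S a c) = x a.

Lemma local_slices S t x : x \in slices S t -> local S x.
Proof.
move=> xS a c; rewrite (coord_span xS) !sum_ffunE; apply: eq_bigr => i _.
rewrite !ffunE; congr (_ *: _).
have /imageP[b _ ->] : [seq slice S c t | c : M]`_i \in [seq slice S c t | c : M].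
  by apply: mem_nth; have := ltn_ord i; rewrite size_image.
by rewrite !ffunE mix_id.
Qed.

(** * Products of tensors and inequalities between flattening ranks *)

Lemma ffun_linear_sum (X : finType) (phi : {linear {ffun X -> K^o} -> K^o}) f :
  phi f = \sum_m f m * phi [ffun m' => (m' == m)%:R].
Proof.
have -> : f = \sum_m f m *: ([ffun m' => (m' == m)%:R] : {ffun X -> K^o}).
  apply/ffunP=> a; rewrite sum_ffunE (bigD1 a) //= !ffunE eqxx.
  rewrite big1 ?addr0 => [|b /negbTE nba]; first by rewrite /GRing.scale /= mulr1.
  by rewrite !ffunE eq_sym nba scaler0.
rewrite linear_sum; apply: eq_bigr => m _; rewrite linearZ; congr (_ * _).
rewrite sum_ffunE (bigD1 m) //= !ffunE eqxx.
rewrite big1 ?addr0 => [|b /negbTE nba]; first by rewrite /GRing.scale /= mulr1.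
by rewrite !ffunE eq_sym nba scaler0.
Qed.

(** For [x] and [y] local to disjoint sets of labels this plays the part of their tensor product. *)
Definition mulf x y : F := [ffun a => x a * y a].

Lemma mulf_is_linear x : linear (mulf x).
Proof.
move=> k y z; apply/ffunP=> a; rewrite !ffunE mulrDr; congr (_ + _).
by rewrite /GRing.scale /= mulrCA.
Qed.

HB.instance Definition _ x :=
  GRing.isLinear.Build K F F *:%R (mulf x) (mulf_is_linear x).

Lemma mulfC x y : mulf x y = mulf y x.
Proof. by apply/ffunP=> a; rewrite !ffunE mulrC. Qed.

Definition mulv A B : {vspace F} :=
  <<[seq mulf x y | x <- (vbasis A : seq _), y <- (vbasis B : seq _)]>>%VS.

Lemma dim_mulv A B : (\dim (mulv A B) <= \dim A * \dim B)%N.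
Proof.
by apply: leq_trans (dim_span _) _; rewrite size_allpairs !size_tuple.
Qed.

Lemma memv_mulf A B x y : x \in A -> y \in B -> mulf x y \in mulv A B.
Proof.
move=> xA yB; rewrite (coord_vbasis yB) linear_sum /=; apply: memv_suml => j _.
rewrite linearZ /=; apply: memvZ; rewrite mulfC (coord_vbasis xA) linear_sum /=.
apply: memv_suml => i _; rewrite linearZ /=; apply: memvZ; rewrite mulfC.
by apply: memv_span; apply: allpairs_f; apply: mem_nth; rewrite size_tuple.
Qed.

(** With the coordinates outside [S1] frozen, a slice along the union expands in a basis of
    [slices S1 t]. The coefficients depend on the coordinates in [S2], and turn out to be
    combinations of slices along [S2]. *)
Lemma slices_mulv S1 S2 t : [disjoint S1 & S2] ->
  (slices (S1 :|: S2) t <= mulv (slices S1 t) (slices S2 t))%VS.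
Proof.
move=> dS; apply/slices_subvP=> c; set b := vbasis (slices S1 t).
have -> : slice (S1 :|: S2) c t = \sum_(i < \dim (slices S1 t)) mulf b`_i
    [ffun a => coord b i (slice S1 (mix S2 a c) t)].
  apply/ffunP=> a; rewrite ffunE sum_ffunE -mixU.
  transitivity (slice S1 (mix S2 a c) t a); first by rewrite ffunE.
  rewrite {1}(coord_vbasis (mem_slice S1 (mix S2 a c) t)) sum_ffunE.
  by apply: eq_bigr => i _; rewrite !ffunE /GRing.scale /= mulrC.
apply: memv_suml => i _; apply: memv_mulf.
  by apply: vbasis_mem; apply: mem_nth; rewrite size_tuple.
(* A coordinate form is a combination of evaluations at multi-indices [m]; evaluating at [m] while
   the [S2]-part varies gives a slice along [S2]. *)
have -> : [ffun a => coord b i (slice S1 (mix S2 a c) t)] =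
    \sum_m coord b i [ffun m' => (m' == m)%:R] *: slice S2 (mix S1 m c) t.
  apply/ffunP=> a; rewrite ffunE sum_ffunE ffun_linear_sum.
  apply: eq_bigr => m _; rewrite !ffunE (mix_disjointC _ _ _ dS).
  by rewrite /GRing.scale /= mulrC.
by apply: memv_suml => m _; apply: memvZ; apply: mem_slice.
Qed.

Lemma flat_rankU S1 S2 t : [disjoint S1 & S2] ->
  (flat_rank (S1 :|: S2) t <= flat_rank S1 t * flat_rank S2 t)%N.
Proof.
by move=> dS; apply: leq_trans (dim_mulv _ _); apply/dimvS/slices_mulv.
Qed.

(** Row rank bounds column rank: a basis [b] of the slices along [S] factorises [t], and the
    cofactors [g i] span a space containing the slices along the complement. *)
Lemma flat_rankC_le S t : (flat_rank (~: S) t <= flat_rank S t)%N.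
Proof.
set b := vbasis (slices S t).
pose g i : F := [ffun a => coord b i (slice S a t)].
have : (slices (~: S) t <= <<[tuple of codom g]>>)%VS.
  apply/slices_subvP=> c.
  have -> : slice (~: S) c t = \sum_(i < \dim (slices S t)) b`_i c *: g i.
    apply/ffunP=> a; rewrite ffunE mixC sum_ffunE.
    transitivity (slice S a t c); first by rewrite ffunE.
    rewrite {1}(coord_vbasis (mem_slice S a t)) sum_ffunE.
    by apply: eq_bigr => i _; rewrite !ffunE /GRing.scale /= mulrC.
  by apply: memv_suml => i _; apply/memvZ/memv_span/codom_f.
move=> /dimvS/leq_trans; apply; apply: leq_trans (dim_span _) _.
by rewrite size_tuple card_ord.
Qed.

Lemma flat_rankC S t : flat_rank (~: S) t = flat_rank S t.
Proof.
by apply/eqP; rewrite eqn_leq flat_rankC_le /= -{1}[S]setCK flat_rankC_le.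
Qed.

Lemma flat_rank_mul S x y :
  (flat_rank S (mulf x y) <= flat_rank S x * flat_rank S y)%N.
Proof.
apply: leq_trans (dim_mulv _ _); apply/dimvS/slices_subvP=> c.
have -> : slice S c (mulf x y) = mulf (slice S c x) (slice S c y).
  by apply/ffunP=> a; rewrite !ffunE.
by apply: memv_mulf; apply: mem_slice.
Qed.

Lemma flat_rank_local S x : local S x -> (flat_rank S x <= 1)%N.
Proof.
move=> xS; apply: (@leq_trans (\dim <[x]>)); last by rewrite dim_vline leq_b1.
apply/dimvS/slices_subvP=> c.
by have -> : slice S c x = x by [apply/ffunP=> a; rewrite ffunE xS]; apply: memv_line.
Qed.

Lemma flat_rank_localC S x : local (~: S) x -> (flat_rank S x <= 1)%N.
Proof. by rewrite -flat_rankC; apply: flat_rank_local. Qed.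

Lemma flat_rank0 x : (flat_rank set0 x <= 1)%N.
Proof. by apply: flat_rank_localC => a c; rewrite setC0 mixT. Qed.

(** The points [p j] cut an identity matrix of size [#|J|] out of the flattening, so the
    corresponding slices are independent. *)
Lemma leq_flat_rank (J : finType) S t (p : J -> M) :
  (forall i j, slice S (p j) t (p i) = (i == j)%:R) -> (#|J| <= flat_rank S t)%N.
Proof.
move=> tp; pose X := [tuple slice S (p (enum_val i)) t | i < #|J|].
have fX : free X.
  apply/freeP=> k k0 i; move/ffunP: k0 => /(_ (p (enum_val i))).
  rewrite sum_ffunE (bigD1 i) //= big1 => [|j ji].
    rewrite [X`_i](_ : _ = slice S (p (enum_val i)) t); last first.
      by rewrite -tnth_nth tnth_mktuple.
    by rewrite ffunE tp eqxx /GRing.scale /= mulr1 addr0 ffunE.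
  rewrite [X`_j](_ : _ = slice S (p (enum_val j)) t); last first.
    by rewrite -tnth_nth tnth_mktuple.
  rewrite ffunE tp (inj_eq enum_val_inj) eq_sym (negbTE ji).
  by rewrite scaler0.
have /eqP <- : \dim <<X>> == #|J| by rewrite -[X in _ == X](size_tuple X).
apply: dimvS; apply/span_subvP=> _ /mapP[i _ ->].
exact: mem_slice.
Qed.

(** * Vertex spaces inside the full tensor space *)

Definition embed (v : tree I) (x : vertex_space V v) : F :=
  [ffun a => to_tensor x (restr (subsetT (leaves v)) a)].

Lemma to_tensor_is_linear (v : tree I) : linear (@to_tensor K I V v).
Proof. by case: v => [i|v1 v2] // k x y; apply/ffunP=> a; rewrite !ffunE linearP. Qed.

Lemma embed_is_linear (v : tree I) : linear (@embed v).
Proof. by move=> k x y; apply/ffunP=> a; rewrite !ffunE to_tensor_is_linear !ffunE. Qed.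

HB.instance Definition _ (v : tree I) :=
  GRing.isLinear.Build K (vertex_space V v) F *:%R (@embed v) (@embed_is_linear v).

Definition embed_lfun (v : tree I) : 'Hom(vertex_space V v, F) := linfun (@embed v).

Lemma embed_lfunE (v : tree I) (x : vertex_space V v) : embed_lfun v x = embed x.
Proof. exact: lfunE. Qed.

Lemma restr_mix S a c :
  restr (subsetT S) (mix S a c) = restr (subsetT S) a.
Proof. by apply/ffunP=> -[i iS]; rewrite !ffunE /= iS. Qed.

Lemma local_embed (v : tree I) (x : vertex_space V v) : local (leaves v) (embed x).
Proof. by move=> a c; rewrite !ffunE restr_mix. Qed.

Lemma restr_restr S1 S2 (sS : S1 \subset S2) a :
  restr sS (restr (subsetT S2) a) = restr (subsetT S1) a.
Proof.
apply/ffunP=> -[i iS]; rewrite !ffunE; congr (a (exist _ _ _)).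
exact: bool_irrelevance.
Qed.

Lemma embed_tmul (v1 v2 : tree I) (x1 : vertex_space V v1) (x2 : vertex_space V v2) :
  @embed (Node v1 v2) (tmul (to_tensor x1) (to_tensor x2)) =
    mulf (embed x1) (embed x2).
Proof. by apply/ffunP=> a; rewrite !ffunE !restr_restr. Qed.

Definition extend S (b : multi_index V S) c : M :=
  [ffun i => match @idP (val i \in S) with
             | ReflectT iS => b (exist _ (val i) iS)
             | ReflectF _ => c i
             end : 'I_(\dim {: V (val i)})].

Lemma restr_extend S (b : multi_index V S) c :
  restr (subsetT S) (extend b c) = b.
Proof.
apply/ffunP=> -[i iS]; rewrite !ffunE /=.
by case: {-}_ / idP => // iS'; rewrite (bool_irrelevance iS' iS).
Qed.

Lemma extend_restr S a c : extend (restr (subsetT S) a) c = mix S a c.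
Proof.
apply/ffunP=> -[i iT]; rewrite !ffunE /=.
case: {-}_ / idP => [iS|/negP/negbTE -> //]; rewrite iS ffunE.
by congr (a (exist _ _ _)); apply: bool_irrelevance.
Qed.

Definition point1 (i : I) (j : 'I_(\dim {: V i})) : multi_index V [set i] :=
  [ffun l => cast_ord (congr1 (fun i => \dim {: V i}) (esym (set1P (valP l)))) j
     : 'I_(\dim {: V (val l)})].

Lemma point1E (i : I) (j : 'I_(\dim {: V i})) :
  point1 j (exist _ i (set11 i)) = j.
Proof. by apply: val_inj; rewrite ffunE. Qed.

Lemma point1K (i : I) (a : multi_index V [set i]) :
  point1 (a (exist _ i (set11 i))) = a.
Proof.
apply/ffunP=> -[l li]; have /set1P eq_li := li; subst l.
by apply: val_inj; rewrite ffunE /= (bool_irrelevance li (set11 i)).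
Qed.

Lemma tensor1_point (i : I) (j : 'I_(\dim {: V i})) (x : V i) :
  tensor1 x (point1 j) = coord (vbasis {: V i}) j x.
Proof. by rewrite ffunE point1E. Qed.

Lemma to_tensor_inj (v : tree I) : injective (@to_tensor K I V v).
Proof.
case: v => [i|v1 v2] x y //= eq_xy.
rewrite (coord_vbasis (memvf x)) (coord_vbasis (memvf y)).
apply: eq_bigr => j _; congr (_ *: _).
by rewrite -!tensor1_point eq_xy.
Qed.

Lemma to_tensor_onto (v : tree I) (f : tensor V (leaves v)) :
  exists x : vertex_space V v, to_tensor x = f.
Proof.
case: v f => [i|v1 v2] f /=; last by exists f.
exists (\sum_j f (point1 j) *: (vbasis {: V i})`_j).
apply/ffunP=> a; rewrite ffunE coord_sum_free ?point1K //.
exact: basis_free (vbasisP _).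
Qed.

(** The multi-index [c] supplies the coordinates outside [leaves v]; its existence means that every
    [V i] is nonzero. *)
Lemma embed_inj (c : M) (v : tree I) : injective (@embed v).
Proof.
move=> x y /ffunP eq_xy; apply/to_tensor_inj/ffunP=> b.
by have := eq_xy (extend b c); rewrite !ffunE restr_extend.
Qed.

Lemma embed_onto (c : M) (v : tree I) f : local (leaves v) f ->
  exists x : vertex_space V v, embed x = f.
Proof.
move=> f_loc; have [x xE] :=
  to_tensor_onto (v := v) [ffun b => f (extend b c)].
by exists x; apply/ffunP=> a; rewrite ffunE xE ffunE extend_restr f_loc.
Qed.

(** * Tensor network states characterised by flattening ranks *)

Definition disjoint_leaves (T : tree I) :=
  forall v1 v2, is_vertex T (Node v1 v2) -> [disjoint leaves v1 & leaves v2].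

Lemma is_vertex_refl (T : tree I) : is_vertex T T.
Proof. by case: T; left. Qed.

Lemma is_vertex_trans (v2 v1 v3 : tree I) :
  is_vertex v1 v2 -> is_vertex v2 v3 -> is_vertex v1 v3.
Proof.
elim: v1 => [i|u1 IH1 u2 IH2] /=; first by case=> [-> //|[]].
by case=> [-> //|[/IH1 h|/IH2 h]] /h ?; right; [left | right].
Qed.

Lemma is_vertex_childl (T v1 v2 : tree I) : is_vertex T (Node v1 v2) -> is_vertex T v1.
Proof. by move=> /is_vertex_trans; apply; right; left; apply: is_vertex_refl. Qed.

Lemma is_vertex_childr (T v1 v2 : tree I) : is_vertex T (Node v1 v2) -> is_vertex T v2.
Proof. by move=> /is_vertex_trans; apply; right; right; apply: is_vertex_refl. Qed.

Lemma slice_mulf S1 S2 x y c : [disjoint S1 & S2] -> local S1 x -> local S2 y ->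
  slice S1 c (mulf x y) = y c *: x.
Proof.
move=> dS xS1 yS2; apply/ffunP=> a; rewrite !ffunE xS1 mulrC; congr (_ * _).
rewrite -(yS2 _ c); congr (y _).
apply: multi_indexP => i; rewrite !coordinate_mix.
have /setP/(_ i) := disjoint_setI0 dS; rewrite !inE.
by case: (i \in S1); case: (i \in S2).
Qed.

Lemma mem_slice_preim (v : tree I) S c (x : vertex_space V v) (W : {vspace F}) :
  (x \in (linfun (slice S c) \o embed_lfun v)%VF @^-1: W)%VS =
    (slice S c (embed x) \in W).
Proof. by rewrite -memv_preim comp_lfunE embed_lfunE lfunE. Qed.

(** Freezing the coordinates outside [leaves v] turns a product of generators into a multiple of the
    generator belonging to [v]. *)
Lemma slice_child_mem (v1 v2 v : tree I) (U : forall v, {vspace vertex_space V v})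
    (w : vertex_space V (Node v1 v2)) c :
    (v = v1 \/ v = v2) -> [disjoint leaves v1 & leaves v2] ->
    w \in tensv (U v1) (U v2) ->
  slice (leaves v) c (embed w) \in (embed_lfun v @: U v)%VS.
Proof.
move=> v12 dv wU.
have : (tensv (U v1) (U v2) <=
    (linfun (slice (leaves v) c) \o embed_lfun (Node v1 v2))%VF @^-1:
      (embed_lfun v @: U v))%VS.
  apply/span_subvP=> _ /allpairsP[[x1 x2] /= [/vbasis_mem x1U /vbasis_mem x2U ->]].
  rewrite (@mem_slice_preim (Node v1 v2)) embed_tmul.
  case: v12 => ->; last rewrite mulfC.
    rewrite (slice_mulf c dv) ?memvZ //; try exact: local_embed.
    by rewrite -embed_lfunE memv_img.
  rewrite disjoint_sym in dv.
  rewrite (slice_mulf c dv) ?memvZ //; try exact: local_embed.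
  by rewrite -embed_lfunE memv_img.
by move/subvP/(_ w wU); rewrite mem_slice_preim.
Qed.

(** The slices along [leaves v] lie in the image of [U v]: this holds at the root and passes from a
    node to its children. *)
Theorem TNS_flat_rank (T : tree I) (f : tree I -> nat) t :
  disjoint_leaves T -> TNS T f t ->
  forall v, is_vertex T v -> (flat_rank (leaves v) t <= f v)%N.
Proof.
move=> dT [U [dimU subU [u uU tE]]].
suff sub v : is_vertex T v -> (slices (leaves v) t <= embed_lfun v @: U v)%VS.
  move=> v vT; apply: leq_trans (dimU v vT); apply: leq_trans (dimvS (sub v vT)) _.
  by rewrite -(limg_ker_dim (embed_lfun v) (U v)) leq_addl.
suff: forall v', is_vertex T v' -> is_vertex v' v ->
    (slices (leaves v') t <= embed_lfun v' @: U v')%VS ->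
    (slices (leaves v) t <= embed_lfun v @: U v)%VS.
  move/(_ T (is_vertex_refl T)) => h /h; apply; apply/slices_subvP=> c.
  have -> : slice (leaves T) c t = embed u.
    by apply/ffunP=> a; rewrite ffunE tE local_embed.
  by rewrite -embed_lfunE memv_img.
elim=> [i|v1 IH1 v2 IH2] v'T /=; first by case=> [->|[]].
move=> vv' sub'.
have child v0 : v0 = v1 \/ v0 = v2 ->
    (slices (leaves v0) t <= embed_lfun v0 @: U v0)%VS.
  move=> v0E; apply/slices_subvP=> c.
  (* Slicing along the leaves of a child may be preceded by slicing along those of the node, so [t]
     is replaced by a member [w] of the space at the node. *)
  have /memv_imgP[w wU wE] := subvP sub' _ (mem_slice (leaves (Node v1 v2)) c t).
  have -> : slice (leaves v0) c t = slice (leaves v0) c (@embed (Node v1 v2) w).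
    move: wE; rewrite (@embed_lfunE (Node v1 v2)) => <-; apply/ffunP=> a; rewrite !ffunE mix_sub //.
    by case: v0E => -> /=; [apply: subsetUl | apply: subsetUr].
  apply: slice_child_mem v0E (dT _ _ v'T) _.
  by apply: subvP wU; apply: subU.
case: vv' => [-> //|[vv|vv]].
- by apply: IH1 (is_vertex_childl v'T) vv _; apply: child; left.
- by apply: IH2 (is_vertex_childr v'T) vv _; apply: child; right.
Qed.

Lemma mulf_embed_tensv (v1 v2 : tree I) (U1 : {vspace vertex_space V v1})
    (U2 : {vspace vertex_space V v2}) (x1 : vertex_space V v1)
    (x2 : vertex_space V v2) : x1 \in U1 -> x2 \in U2 ->
  mulf (embed x1) (embed x2) \in (embed_lfun (Node v1 v2) @: tensv U1 U2)%VS.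
Proof.
move=> x1U x2U; rewrite (coord_vbasis x2U) !linear_sum /=; apply: memv_suml => j _.
rewrite !linearZ /=; apply: memvZ; rewrite mulfC (coord_vbasis x1U) !linear_sum /=.
apply: memv_suml => i _; rewrite !linearZ /=; apply: memvZ; rewrite mulfC.
rewrite -embed_tmul -(@embed_lfunE (Node v1 v2)); apply/memv_img/memv_span.
by apply: allpairs_f; apply: mem_nth; rewrite size_tuple.
Qed.

(** The preimages of the spaces of slices are admissible: [slices_mulv] is the condition at a node,
    and [c] makes each embedding a bijection onto the local tensors. *)
Theorem flat_rank_TNS (c : M) (T : tree I) (f : tree I -> nat) t :
  disjoint_leaves T -> leaves T = [set: I] ->
  (forall v, is_vertex T v -> (flat_rank (leaves v) t <= f v)%N) -> TNS T f t.
Proof.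
move=> dT leavesT rk; have E_inj v : lker (embed_lfun v) == 0%VS.
  by apply/lker0P=> x y; rewrite !embed_lfunE; apply: embed_inj.
have EU v : (embed_lfun v @: (embed_lfun v @^-1: slices (leaves v) t))%VS = slices (leaves v) t.
  apply: lpreimK; apply/subvP=> x /local_slices /(embed_onto c)[y <-].
  by rewrite -embed_lfunE memv_img ?memvf.
exists (fun v => embed_lfun v @^-1: slices (leaves v) t)%VS; split=> [v vT|v1 v2 vT|].
- rewrite -(@limg_dim_eq _ _ _ (embed_lfun v)) ?EU ?rk //.
  by rewrite (eqP (E_inj v)) capv0.
- apply/subvP=> x; rewrite -memv_preim embed_lfunE => /(subvP (slices_mulv t (dT _ _ vT))).
  set U := tensv _ _ => xP.
  suff: embed x \in (embed_lfun (Node v1 v2) @: U)%VS.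
    by case/memv_imgP=> y yU; rewrite embed_lfunE => /(embed_inj c) ->.
  apply: subvP xP; apply/span_subvP=> _ /allpairsP[[y1 y2] /= [/vbasis_mem + /vbasis_mem + ->]].
  rewrite -{1}(EU v1) -{1}(EU v2) => /memv_imgP[x1 x1U ->] /memv_imgP[x2 x2U ->].
  by rewrite !embed_lfunE mulf_embed_tensv.
- have: t \in slices (leaves T) t.
    have {1}<- : slice setT c t = t by apply/ffunP=> a; rewrite ffunE mixT.
    by rewrite leavesT mem_slice.
  rewrite -{1}EU => /memv_imgP[u uU tE]; exists u => //.
  by rewrite [LHS]tE embed_lfunE.
Qed.

End Slices.

(** * Leaf sets of the two trees *)

Lemma disjoint_leaves_Node (I : finType) (T1 T2 : tree I) :
  disjoint_leaves T1 -> disjoint_leaves T2 -> [disjoint leaves T1 & leaves T2] ->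
  disjoint_leaves (Node T1 T2).
Proof.
by move=> d1 d2 d12 v1 v2 /= [[-> ->] //|[]]; [apply: d1 | apply: d2].
Qed.

Lemma disjoint_leaves_Leaf (I : finType) (i : I) : disjoint_leaves (Leaf i).
Proof. by move=> v1 v2 []. Qed.

(** * Train track trees over a list of leaves *)

Section Caterpillar.

Variables (I : finType) (i : I).
Implicit Types (l : seq I) (v : tree I).

Definition caterpillar l := foldl (fun T j => Node T (Leaf j)) (Leaf i) l.

Lemma caterpillar_rcons l j :
  caterpillar (rcons l j) = Node (caterpillar l) (Leaf j).
Proof. by rewrite /caterpillar foldl_rcons. Qed.

Lemma leaves_caterpillar l : leaves (caterpillar l) = [set j in i :: l].
Proof.
elim/last_ind: l => [|l j IHl]; first by apply/setP=> x; rewrite !inE.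
rewrite caterpillar_rcons /= IHl; apply/setP=> x.
by rewrite !inE mem_rcons inE; do !case: (_ == _) => //=; rewrite orbC.
Qed.

Lemma caterpillar_take l m : is_vertex (caterpillar l) (caterpillar (take m l)).
Proof.
elim/last_ind: l => [|l j IHl]; first exact: is_vertex_refl.
have [ml | lm] := leqP m (size l).
  by rewrite caterpillar_rcons -cats1 takel_cat //; right; left.
by rewrite take_oversize ?size_rcons //; apply: is_vertex_refl.
Qed.

Lemma leaves_caterpillar_vertex l v : is_vertex (caterpillar l) v ->
  (exists j, leaves v = [set j]) \/ exists m, leaves v = [set j in take m (i :: l)].
Proof.
elim/last_ind: l v => [|l j IHl] v; first by case=> [->|[]]; left; exists i.
rewrite caterpillar_rcons; case=> [->|[/IHl[[x xE]|[m mE]]|[->|[]]]].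
- right; exists (size (i :: rcons l j)).
  by rewrite take_size -caterpillar_rcons leaves_caterpillar.
- by left; exists x.
- right; exists (minn m (size l).+1); rewrite mE -rcons_cons -cats1 takel_cat ?geq_minr //.
  have [//|ml] := leqP m (size l).+1.
  by rewrite !take_oversize //= ltnW.
- by left; exists j.
Qed.

Lemma disjoint_leaves_caterpillar l : uniq (i :: l) -> disjoint_leaves (caterpillar l).
Proof.
elim/last_ind: l => [|l j IHl] Ul; first exact: disjoint_leaves_Leaf.
move: Ul; rewrite -rcons_cons rcons_uniq caterpillar_rcons => /andP[jl Ul].
apply: disjoint_leaves_Node (IHl Ul) _ _; first exact: disjoint_leaves_Leaf.
by rewrite leaves_caterpillar disjoint_sym disjoints1 inE.
Qed.

End Caterpillar.

Section TrainTrack.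

Variables (n : nat) (n_gt0 : 0 < n) (s : {perm 'I_n}).

(** [s^-1] sends a leaf to its position in the train track. *)
Definition prefix m : {set 'I_n} := [set i | (s^-1)%g i < m].

Lemma train_track_caterpillar :
  { l | s (Ordinal n_gt0) :: l = map s (enum 'I_n) &
        train_track_tree n_gt0 s = caterpillar (s (Ordinal n_gt0)) l }.
Proof.
exists (map s (behead (enum 'I_n))).
  rewrite -map_cons; congr map; apply: (inj_map val_inj).
  by rewrite /= -behead_map val_enum_ord; case: n n_gt0.
rewrite /train_track_tree /caterpillar; move: (Leaf _) (behead _) => T l.
by elim: l T => //=.
Qed.

Lemma prefixE m : [set j in take m (map s (enum 'I_n))] = prefix m.
Proof.
apply/setP=> i; rewrite !inE -map_take -{1}[i](permKV s) mem_map; last exact: perm_inj.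
by rewrite in_take ?mem_enum // index_enum_ord.
Qed.

Lemma disjoint_leaves_train_track : disjoint_leaves (train_track_tree n_gt0 s).
Proof.
have [l lE ->] := train_track_caterpillar; apply: disjoint_leaves_caterpillar.
by rewrite lE map_inj_uniq ?enum_uniq //; apply: perm_inj.
Qed.

Lemma leaves_train_track : leaves (train_track_tree n_gt0 s) = [set: 'I_n].
Proof.
have [l lE ->] := train_track_caterpillar; rewrite leaves_caterpillar lE.
apply/setP=> i; rewrite !inE -[i](permKV s) mem_map ?mem_enum //.
exact: perm_inj.
Qed.

(** The successor excludes the empty prefix, which belongs to no vertex. *)
Lemma train_track_prefix m :
  exists2 v, is_vertex (train_track_tree n_gt0 s) v & leaves v = prefix m.+1.
Proof.
have [l lE ->] := train_track_caterpillar.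
exists (caterpillar (s (Ordinal n_gt0)) (take m l)); first exact: caterpillar_take.
by rewrite leaves_caterpillar -prefixE -lE.
Qed.

Lemma leaves_train_track_vertex v : is_vertex (train_track_tree n_gt0 s) v ->
  (exists i, leaves v = [set i]) \/ exists m, leaves v = prefix m.
Proof.
have [l lE ->] := train_track_caterpillar => /leaves_caterpillar_vertex[|[m vE]].
  by left.
by right; exists m; rewrite vE lE prefixE.
Qed.

End TrainTrack.

(** * Perfect binary trees *)

Section Perfect.

Variable n : nat.

Definition interval a b : {set 'I_n} := [set i : 'I_n | a <= i < b].

(** The offset [a] is there for the induction, which meets the right half with a shifted start. *)
Lemma leaves_perfect k (g : 'I_(2 ^ k) -> 'I_n) a :
  (forall j, g j = a + j :> nat) ->
  leaves (perfect_tree g) = interval a (a + 2 ^ k).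
Proof.
elim: k g a => [|k IHk] g a gE /=.
  apply/setP=> i; rewrite !inE -val_eqE /= gE addn0 addn1 ltnS.
  by rewrite eqn_leq andbC.
rewrite (IHk _ a) => [|j]; last by rewrite gE.
rewrite (IHk _ (a + 2 ^ k)) => [|j]; last by rewrite gE addnA.
rewrite -addnA pow2_split; apply/setP=> i; rewrite !inE.
have := pow2_split k; move: (2 ^ k) (2 ^ k.+1) => p q <-.
by lia.
Qed.

Lemma perfect_vertexP k (g : 'I_(2 ^ k) -> 'I_n) a v :
  (forall j, g j = a + j :> nat) -> is_vertex (perfect_tree g) v ->
  exists b c, leaves v = interval b c.
Proof.
elim: k g a => [|k IHk] g a gE.
  by case=> [->|[]]; exists a, (a + 2 ^ 0); rewrite -(leaves_perfect gE).
case=> [->|[]]; first by exists a, (a + 2 ^ k.+1); rewrite -(leaves_perfect gE).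
  by apply: (IHk _ a) => j; rewrite gE.
by apply: (IHk _ (a + 2 ^ k)) => j; rewrite gE addnA.
Qed.

Lemma disjoint_leaves_perfect k (g : 'I_(2 ^ k) -> 'I_n) a :
  (forall j, g j = a + j :> nat) -> disjoint_leaves (perfect_tree g).
Proof.
elim: k g a => [|k IHk] g a gE; first exact: disjoint_leaves_Leaf.
apply: disjoint_leaves_Node => /=.
- by apply: (IHk _ a) => j; rewrite gE.
- by apply: (IHk _ (a + 2 ^ k)) => j; rewrite gE addnA.
rewrite (leaves_perfect (a := a)) => [|j]; last by rewrite gE.
rewrite (leaves_perfect (a := a + 2 ^ k)) => [|j]; last by rewrite gE addnA.
rewrite -setI_eq0; apply/eqP/setP=> i; rewrite !inE.
by case: (leqP (a + 2 ^ k) i) => // _; rewrite !andbF.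
Qed.

Lemma perfect_pair k (g : 'I_(2 ^ k) -> 'I_n) a q :
  (forall j, g j = a + j :> nat) -> q.*2.+1 < 2 ^ k ->
  exists2 v, is_vertex (perfect_tree g) v &
    leaves v = interval (a + q.*2) (a + q.*2.+2).
Proof.
elim: k g a q => [|k IHk] g a q gE; first by rewrite expn0 ltnS.
case: k IHk g gE => [|k] IHk g gE lt_q.
  exists (perfect_tree g); first exact: is_vertex_refl.
  by case: q lt_q => //; rewrite (leaves_perfect gE) addn0.
have [lt_q' | ge_q] := ltnP q.*2.+1 (2 ^ k.+1).
  have [|v vT vE] := IHk (fun i => g (cast_ord (pow2_split k.+1) (lshift _ i))) a q _ lt_q'.
    by move=> j; rewrite gE.
  by exists v => //; right; left.
(* The left half has [2 ^ k.+1] leaves, hence [2 ^ k] pairs, which are subtracted from [q]. *)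
have [||v vT vE] := IHk (fun i => g (cast_ord (pow2_split k.+1) (rshift _ i)))
  (a + 2 ^ k.+1) (q - 2 ^ k).
- by move=> j; rewrite gE addnA.
- by move: ge_q lt_q; rewrite !expnS; move: (2 ^ k) => p; lia.
exists v; first by right; right.
rewrite vE; move: ge_q; rewrite expnS; move: (2 ^ k) => p le_pq.
by congr (interval _ _); lia.
Qed.

End Perfect.

(** * Tensors linking two pairs of leaves *)

Section LinkedPairs.

Local Open Scope ring_scope.

Variables (K : fieldType) (I : finType) (V : I -> vectType K).

Notation M := (multi_index V [set: I]).
Notation F := (tensor V [set: I]).

Definition multi_index_of (h : I -> nat) (lt_h : forall i, (h i < \dim {: V i})%N) : M :=
  [ffun i => Ordinal (lt_h (val i)) : 'I_(\dim {: V (val i)})].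

Lemma coordinate_multi_index_of h lt_h i :
  coordinate (@multi_index_of h lt_h) i = h i :> nat.
Proof. by rewrite /coordinate ffunE. Qed.

Definition pin (A : {set I}) : F :=
  [ffun m => [forall i, (i \notin A) ==> (coordinate m i == 0%N :> nat)]%:R].

(** The conditions on single leaves split into those on leaves in [S] and those on leaves outside,
    and each factor is local to its side. *)
Lemma flat_rank_pin S A : (flat_rank S (pin A) <= 1)%N.
Proof.
have -> : pin A = mulf (pin (A :|: ~: S)) (pin (A :|: S)).
  apply/ffunP=> m; rewrite !ffunE -natrM mulnb; congr (_%:R); congr nat_of_bool.
  apply/forallP/andP=> [m0 | [/forallP m1 /forallP m2] i].
    by split; apply/forallP=> i; have := m0 i; rewrite !inE; case: (i \in A); case: (i \in S).
  by have := m1 i; have := m2 i; rewrite !inE; case: (i \in A); case: (i \in S).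
apply: leq_trans (flat_rank_mul _ _ _) _; rewrite -[1%N]muln1; apply: leq_mul.
  apply: flat_rank_local => m c; rewrite !ffunE; congr (_%:R); congr nat_of_bool.
  apply: eq_forallb => i; rewrite !inE coordinate_mix.
  by case: (i \in S); rewrite ?orbT.
apply: flat_rank_localC => m c; rewrite !ffunE; congr (_%:R); congr nat_of_bool.
apply: eq_forallb => i; rewrite !inE coordinate_mix inE.
by case: (i \in S); rewrite ?orbT.
Qed.

Variable r : nat.
Implicit Types (S : {set I}) (a b c d : I).

(** For distinct [a] and [c], the sum over [x < r] of [e_x] at [a] times [e_x] at [c], constant in
    the other coordinates. *)
Definition link (a c : I) : F :=
  [ffun m => ((coordinate m a == coordinate m c :> nat) && (coordinate m a < r)%N)%:R].

Lemma linkC a c : link a c = link c a.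
Proof.
apply/ffunP=> m; rewrite !ffunE eq_sym; congr (_%:R); congr nat_of_bool.
by case: eqP => //= ->.
Qed.

Lemma flat_rank_link_le1 S a c :
  (a \in S) = (c \in S) -> (flat_rank S (link a c) <= 1)%N.
Proof.
move=> acS; case: (boolP (a \in S)) (acS) => [aS /esym cS | /negbTE aS /esym cS].
  by apply: flat_rank_local => m b; rewrite !ffunE !coordinate_mix aS cS.
by apply: flat_rank_localC => m b; rewrite !ffunE !coordinate_mix !inE aS cS.
Qed.

Lemma flat_rank_link S a c : (0 < r)%N -> (flat_rank S (link a c) <= r)%N.
Proof.
move=> r_gt0; case: (eqVneq (a \in S) (c \in S)) => [acS|].
  exact: leq_trans (flat_rank_link_le1 acS) _.
wlog aS : a c / a \in S => [hw|].
  case: (boolP (a \in S)) => [aS acS | aS]; first by apply: (hw _ _ aS); rewrite aS.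
  case: (boolP (c \in S)) => // cS _; rewrite linkC; apply: (hw _ _ cS).
  by rewrite cS (negbTE aS).
rewrite aS; case: (boolP (c \in S)) => // cS _.
(* Fixing the coordinate at [c], outside [S], leaves some [e x] or zero, so [r] tensors span all
   slices. *)
pose e (x : 'I_r) : F := [ffun m => (coordinate m a == x :> nat)%:R].
apply: (@leq_trans (\dim <<[tuple of codom e]>>)); last first.
  by apply: leq_trans (dim_span _) _; rewrite size_tuple card_ord.
apply/dimvS/slices_subvP=> b.
have [lt_b|ge_b] := ltnP (coordinate b c) r.
  have -> : slice S b (link a c) = e (Ordinal lt_b).
    apply/ffunP=> m; rewrite !ffunE !coordinate_mix aS (negbTE cS) /=.
    by case: eqP => //= ->; rewrite lt_b.
  by apply/memv_span/codom_f.
have -> : slice S b (link a c) = 0; last exact: mem0v.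
apply/ffunP=> m; rewrite !ffunE !coordinate_mix aS (negbTE cS).
by case: eqP => //= ->; rewrite ltnNge ge_b.
Qed.

Definition linked_pairs (a b c d : I) : F :=
  mulf (mulf (link a c) (link b d)) (pin [set a; b; c; d]).

(** A link with both ends on the same side of [S] has rank at most one, as has the pinning factor;
    only the other link can contribute [r]. *)
Lemma flat_rank_linked_pairs_le S a b c d : (0 < r)%N ->
    ~~ (((a \in S) != (c \in S)) && ((b \in S) != (d \in S))) ->
  (flat_rank S (linked_pairs a b c d) <= r)%N.
Proof.
move=> r_gt0 nsep; apply: leq_trans (flat_rank_mul _ _ _) _; rewrite -[r in (_ <= r)%N]muln1.
apply: leq_mul (flat_rank_pin _ _); apply: leq_trans (flat_rank_mul _ _ _) _.
move: nsep; rewrite negb_and !negbK => /orP[/eqP/flat_rank_link_le1|/eqP/flat_rank_link_le1] h.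
  by rewrite -[r in (_ <= r)%N]mul1n; apply: leq_mul h (flat_rank_link _ _ _ _).
by rewrite -[r in (_ <= r)%N]muln1; apply: leq_mul (flat_rank_link _ _ _ _) h.
Qed.

Lemma flat_rank_linked_pairs_ge S a b c d : (0 < r)%N ->
    (forall i, r <= \dim {: V i})%N -> uniq [:: a; b; c; d] ->
    a \in S -> b \in S -> c \notin S -> d \notin S ->
  (r ^ 2 <= flat_rank S (linked_pairs a b c d))%N.
Proof.
move=> r_gt0 dimV U aS bS /negbTE cS /negbTE dS.
(* The point [(x, y)] has [x] at [a] and [c], [y] at [b] and [d], and 0 elsewhere. A mix of two such
   points along [S] satisfies both links only if they coincide. *)
pose h (xy : 'I_r * 'I_r) i : nat :=
  if i \in [:: a; c] then nat_of_ord xy.1 else if i \in [:: b; d] then nat_of_ord xy.2 else 0%N.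
have lt_h xy i : (h xy i < \dim {: V i})%N.
  by apply: leq_trans (dimV i); rewrite /h; do 2!case: ifP => // _.
have <- : #|{: 'I_r * 'I_r}| = (r ^ 2)%N by rewrite card_prod !card_ord.
apply: (leq_flat_rank (p := fun xy => multi_index_of (lt_h xy))) => -[x y] [x' y'].
rewrite !ffunE !coordinate_mix aS bS cS dS !coordinate_multi_index_of /h /=.
move: U; rewrite /= !inE !negb_or !andbT => /and3P[/and3P[ab ac ad] /andP[bc bd] cd].
rewrite !eqxx /= !orbT (eq_sym b a) (negbTE ab) (negbTE bc) (eq_sym d a) (negbTE ad).
rewrite (eq_sym d c) (negbTE cd) /= !ltn_ord !andbT.
have -> : [forall i, (i \notin [set a; b; c; d]) ==> (coordinate
    (mix S (multi_index_of (lt_h (x, y))) (multi_index_of (lt_h (x', y')))) i == 0%N :> nat)].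
  apply/forallP=> i; rewrite !inE !negb_or coordinate_mix.
  apply/implyP=> /andP[/andP[/andP[ia ib] ic] id].
  by case: ifP; rewrite coordinate_multi_index_of /h !inE (negbTE ia) (negbTE ib)
    (negbTE ic) (negbTE id).
by rewrite mulr1 -natrM mulnb.
Qed.

End LinkedPairs.

(** * Intervals from prefixes, and the inclusion *)

Lemma interval_prefix n a b :
  a <= b -> interval n a b = ~: (prefix 1 a :|: ~: prefix 1 b).
Proof.
move=> ab; apply/setP=> i; rewrite !inE invg1 perm1 negb_or negbK -leqNgt //.
Qed.

Lemma TT_sub_HF (K : fieldType) (k r : nat) (V : 'I_(2 ^ k) -> vectType K) t :
  0 < r -> (forall i, 0 < \dim {: V i}) ->
  TT (pow2_gt0 k) 1%g r t -> HF (V := V) (r ^ 2) t.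
Proof.
move=> r_gt0 dimV /(TNS_flat_rank (@disjoint_leaves_train_track _ _ _)) rk.
have rk_prefix m : flat_rank (prefix 1 m) t <= r.
  case: m => [|m].
    have -> : prefix 1 0 = set0 :> {set 'I_(2 ^ k)} by apply/setP=> i; rewrite !inE.
    exact: leq_trans (flat_rank0 _) r_gt0.
  by have [v vT <-] := train_track_prefix (pow2_gt0 k) 1 m; apply: rk.
have gE (j : 'I_(2 ^ k)) : j = 0 + j :> nat by [].
have dis := disjoint_leaves_perfect (g := fun i : 'I_(2 ^ k) => i) gE.
refine (flat_rank_TNS (multi_index_of dimV) dis _ _).
  by rewrite (leaves_perfect gE); apply/setP=> i; rewrite !inE add0n ltn_ord.
move=> v /(perfect_vertexP gE)[a [b ->]].
(* [perfect_vertexP] does not record the order of the two ends; a reversed interval is empty. *)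
have [ab|ba] := leqP a b; last first.
  have -> : interval (2 ^ k) a b = set0 by apply/setP=> i; rewrite !inE; lia.
  by apply: leq_trans (flat_rank0 _) _; rewrite expn_gt0 r_gt0.
rewrite (interval_prefix _ ab) flat_rankC; apply: leq_trans (flat_rankU _ _) _.
  by rewrite -setI_eq0; apply/eqP/setP=> i; rewrite !inE invg1 perm1; lia.
by rewrite flat_rankC -mulnn leq_mul.
Qed.

(* [(p < m) != (p' < m)] says that the cut before position m separates p from
   p'; the last two hypotheses say that {p, q} is not an end pair. *)
Lemma noncrossing_partners n p q : 3 < n -> p != q -> p < n -> q < n ->
  (1 < p) || (1 < q) -> (p < n - 2) || (q < n - 2) ->
  exists p' q', [/\ p' < n, q' < n, uniq [:: p; q; p'; q'] &
    forall m, ~~ (((p < m) != (p' < m)) && ((q < m) != (q' < m)))].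
Proof.
move=> n4; wlog pq : p q / p < q => [hw|].
  rewrite neq_ltn => /orP[pq|qp] pn qn; first by apply: hw => //; rewrite neq_ltn pq.
  rewrite orbC [(p < _) || _]orbC => h1 h2.
  have q_neq_p : q != p by rewrite neq_ltn qp.
  have [q' [p' [q'n p'n U H]]] := hw _ _ qp q_neq_p qn pn h1 h2.
  exists p', q'; split=> // [|m]; last by rewrite andbC.
  by move: U; rewrite /= !inE; lia.
move=> _ pn qn h1 h2.
(* In each case below the intervals spanned by [p, p'] and by [q, q'] are disjoint, so no cut meets
   both. The hypotheses on end pairs keep the partners in range and distinct from [p] and [q]. *)
have [p0|p0] := posnP p; last first.
  have [qE|qE] := eqVneq q p.+1.
    exists p.-1, q.+1; split; rewrite /= ?inE; lia.
  exists p.-1, p.+1; split; rewrite /= ?inE; lia.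
have [qn'|qn'] := ltnP q.+1 n.
  exists p.+1, q.+1; split; rewrite /= ?inE; lia.
exists p.+1, q.-1; split; rewrite /= ?inE; lia.
Qed.

(** By injectivity, at most one of the three pairs fills the first two positions and at most one the
    last two, so a pair is left over. *)
Lemma non_end_pair n (f : nat -> nat) :
    (forall i, i < 6 -> f i < n) ->
    (forall i j, i < 6 -> j < 6 -> f i = f j -> i = j) ->
  exists q, [/\ q < 3, (1 < f q.*2) || (1 < f q.*2.+1) &
    (f q.*2 < n - 2) || (f q.*2.+1 < n - 2)].
Proof.
move=> f_lt f_inj; pose low q := (f q.*2 <= 1) && (f q.*2.+1 <= 1).
pose high q := (n - 2 <= f q.*2) && (n - 2 <= f q.*2.+1).
have dis p q : p < q < 3 -> [/\ f p.*2 != f p.*2.+1, f p.*2 != f q.*2,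
    f p.*2.+1 != f q.*2, f p.*2 < n & f p.*2.+1 < n] /\ f q.*2 < n.
  by move=> pq; split; [split|]; try (by apply: f_lt; lia);
    apply/eqP=> /f_inj; lia.
have low1 p q : p < q < 3 -> low p -> ~~ low q.
  by rewrite /low => /dis[[]]; lia.
have high1 p q : p < q < 3 -> high p -> ~~ high q.
  by rewrite /high => /dis[[]]; lia.
have ok q : q < 3 -> ~~ low q -> ~~ high q -> exists q, [/\ q < 3,
    (1 < f q.*2) || (1 < f q.*2.+1) & (f q.*2 < n - 2) || (f q.*2.+1 < n - 2)].
  by rewrite /low /high; exists q; split; lia.
have [l0|l0] := boolP (low 0).
  have [h1|h1] := boolP (high 1); last by apply: (ok 1) h1 => //; apply: low1 l0.
  by apply: (ok 2) => //; [apply: low1 l0 | apply: high1 h1].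
have [h0|h0] := boolP (high 0); last exact: (ok 0).
have [l1|l1] := boolP (low 1); last by apply: (ok 1) l1 _ => //; apply: high1 h0.
by apply: (ok 2) => //; [apply: low1 l1 | apply: high1 h0].
Qed.

(** * Train track tensors violating a smaller bound *)

Lemma TT_not_sub_HF (K : fieldType) (k r r' : nat) (V : 'I_(2 ^ k) -> vectType K)
    (s : {perm 'I_(2 ^ k)}) :
  0 < r -> 2 < k -> (forall i, r <= \dim {: V i}) -> r' < r ^ 2 ->
  exists2 t, TT (V := V) (pow2_gt0 k) s r t & ~ HF r' t.
Proof.
move=> r_gt0 k_gt2 dimV lt_r'.
have dimV0 i : 0 < \dim {: V i} := leq_trans r_gt0 (dimV i).
(* Depth at least three provides the six leaves of the three sibling pairs. *)
have n8 : 7 < 2 ^ k by apply: (@leq_trans (2 ^ 3)); rewrite ?leq_exp2l.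
have gE (j : 'I_(2 ^ k)) : j = 0 + j :> nat by [].
have dis := disjoint_leaves_perfect (g := fun i : 'I_(2 ^ k) => i) gE.
pose pos i : nat := (s^-1)%g i.
have pos_inj : injective pos by move=> i j /val_inj/perm_inj.
pose label l : 'I_(2 ^ k) := insubd (Ordinal (pow2_gt0 k)) l.
have labelE l : l < 6 -> label l = l :> nat.
  by move=> l6; rewrite val_insubd (leq_trans l6) // (leq_trans _ n8).
have [||q [lt_q h1 h2]] := @non_end_pair (2 ^ k) (pos \o label).
- by move=> l _; apply: ltn_ord.
- by move=> l m l6 m6 /pos_inj/(congr1 val) /=; rewrite !labelE.
pose i := label q.*2; pose j := label q.*2.+1.
have iE : i = q.*2 :> nat by apply: labelE; lia.
have jE : j = q.*2.+1 :> nat by apply: labelE; lia.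
have ij : pos i != pos j by rewrite (inj_eq pos_inj) -val_eqE /= iE jE; lia.
have [|||p' [q' [p'n q'n U nc]]] :=
  @noncrossing_partners (2 ^ k) (pos i) (pos j) _ ij _ _ h1 h2; rewrite ?ltn_ord //.
  exact: leq_trans n8.
(* The partners were found as positions; [s] turns them back into leaves. *)
pose c := s (Ordinal p'n); pose d := s (Ordinal q'n).
have posc : pos c = p' by rewrite /pos /c permK.
have posd : pos d = q' by rewrite /pos /d permK.
have Uijcd : uniq [:: i; j; c; d].
  by rewrite -(map_inj_uniq pos_inj) /= -/(pos i) posc posd.
exists (linked_pairs V r i j c d).
  refine (flat_rank_TNS (multi_index_of dimV0) (@disjoint_leaves_train_track _ _ s)
    (leaves_train_track _ s) _) => v /leaves_train_track_vertex vE.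
  apply: flat_rank_linked_pairs_le => //.
  case: vE => [[l ->]|[m ->]]; last by rewrite !inE -!/(pos _) posc posd; apply: nc.
  (* A singleton contains at most one of the four distinct leaves, so it separates at most one of
     the two linked pairs. *)
  have at_most1 x y : x != y -> ~~ ((x == l) && (y == l)).
    by apply: contraNN => /andP[/eqP-> /eqP->].
  move: Uijcd; rewrite /= !inE !negb_or !andbT => /and3P[/and3P[ij' _ id] /andP[jc _] cd'].
  move: (at_most1 _ _ ij') (at_most1 _ _ id) (at_most1 _ _ jc) (at_most1 _ _ cd').
  by case: (i == l); case: (j == l); case: (c == l); case: (d == l).
move=> /(TNS_flat_rank dis) rk.
have [|v vT vE] := @perfect_pair _ k id 0 q gE.
  by apply: leq_trans n8; lia.
suff : r ^ 2 <= r' by rewrite leqNgt lt_r'.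
apply: leq_trans (rk v vT); apply: flat_rank_linked_pairs_ge => //.
all: rewrite vE !inE ?iE ?jE; try lia.
all: move: Uijcd; rewrite /= !inE -!val_eqE /= iE jE; lia.
Qed.

(** For [r = 1] the only smaller bound is 0, which admits no nonzero tensor, while [e_0] at every
    leaf gives a nonzero pure tensor. *)
Lemma TT1_not_sub_HF0 (K : fieldType) (k : nat) (V : 'I_(2 ^ k) -> vectType K)
    (s : {perm 'I_(2 ^ k)}) : (forall i, 0 < \dim {: V i}) ->
  exists2 t, TT (V := V) (pow2_gt0 k) s 1 t & ~ HF 0 t.
Proof.
move=> dimV; exists (pin V set0).
  refine (flat_rank_TNS (multi_index_of dimV) (@disjoint_leaves_train_track _ _ s)
    (leaves_train_track _ s) _) => v _; exact: flat_rank_pin.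
have gE (j : 'I_(2 ^ k)) : j = 0 + j :> nat by [].
have dis := disjoint_leaves_perfect (g := fun i : 'I_(2 ^ k) => i) gE.
move=> /(TNS_flat_rank dis)/(_ _ (is_vertex_refl _)).
rewrite leqNgt => /negP[]; apply: leq_trans (_ : #|{: unit}| <= _); first by rewrite card_unit.
apply: (leq_flat_rank (p := fun=> multi_index_of dimV)) => -[] [].
rewrite !ffunE mixaa; suff -> : [forall i, (i \notin set0) ==>
    (coordinate (multi_index_of dimV) i == 0 :> nat)] by [].
by apply/forallP=> i; rewrite inE coordinate_multi_index_of.
Qed.

(** The second part assumes [r = 1] or [k >= 3] because it fails otherwise. For [r >= 2] and the
    standard order, the bound [r' = r < r ^ 2] gives an inclusion: for [k = 1] the two trees
    coincide, and for [k = 2] the first two leaves form a prefix, and the last two its complement,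
    both of rank at most [r]. *)
Theorem proposition1p4 (K : fieldType) (r k : nat)
    (V : 'I_(2 ^ k) -> vectType K)
    (r_gt0 : (0 < r)%N) (k_gt0 : (0 < k)%N)
    (dimV : forall i : 'I_(2 ^ k), (r <= \dim (fullv : {vspace V i}))%N) :
  (forall t : tensor V [set: 'I_(2 ^ k)],
     TT (pow2_gt0 k) 1%g r t -> HF (r ^ 2) t) /\
  (r = 1%N \/ (3 <= k)%N ->
   forall (r' : nat) (s : {perm 'I_(2 ^ k)}), (r' < r ^ 2)%N ->
     ~ (forall t : tensor V [set: 'I_(2 ^ k)],
          TT (pow2_gt0 k) s r t -> HF r' t)).
Proof.
have dimV0 i : 0 < \dim {: V i} := leq_trans r_gt0 (dimV i).
split=> [t|[r1|k_ge3] r' s lt_r' sub]; first exact: TT_sub_HF.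
- move: lt_r' sub; rewrite r1 ltnS leqn0 => /eqP -> sub.
  by have [t tTT] := TT1_not_sub_HF0 s dimV0; apply; apply: sub.
- by have [t tTT] := TT_not_sub_HF s r_gt0 k_ge3 dimV lt_r'; apply; apply: sub.
Qed.
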